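(* Let $N\in\mathbb{N}$ be given. Then there exists a probability measure $\mu$ on $[0,1]$ with continuous density function such that $\mu(I(\mathbf{a}))=\mu(I(\overleftarrow{\mathbf{a}}))$ for all strings $\mathbf{a}=(a_1,\dots,a_n)$ of positive integers of length $n\le N$, but $\mu\neq\mu_{GK}$.
   Context: Every $x\in[0,1)$ has a continued fraction expansion $x=[0;a_1(x),a_2(x),\dots]=\cfrac{1}{a_1(x)+\cfrac{1}{a_2(x)+\cdots}}$ with positive integer digits $a_i(x)$; it is infinite and unique for irrational $x$, and finite for rational $x$, where it is made unique by requiring the last digit to be strictly greater than $1$. For a finite string $\mathbf{a}=(a_1,\dots,a_n)$ of positive integers, $I(\mathbf{a})=\{x\in[0,1): a_i(x)=a_i \text{ for } i=1,\dots,n\}$. The reverse of $\mathbf{a}$ is $\overleftarrow{\mathbf{a}}=(a_n,\dots,a_1)$. The Gauss--Kuzmin measure is the measure $\mu_{GK}$ on $[0,1]$ given by $\mu_{GK}(I)=\frac{1}{\log 2}\int_I\frac{dx}{1+x}$. *)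

(* Defs.v *)
From mathcomp Require Import all_boot all_order all_algebra.
From mathcomp Require Import all_classical all_reals all_analysis.

Set Implicit Arguments.
Unset Strict Implicit.
Unset Printing Implicit Defensive.

Import Order.TTheory GRing.Theory Num.Theory.
Import numFieldNormedType.Exports.

Local Open Scope classical_set_scope.
Local Open Scope ring_scope.

(* [0; a_1, ..., a_n] for s = [:: a_1; ...; a_n]; the empty fraction is 0. *)
Definition cf_value (R : realType) (s : seq nat) : R :=
  foldr (fun (a : nat) (y : R) => (a%:R + y)^-1) 0 s.

Inductive cf_expansion : Type :=
  | FiniteCF of seq nat
  | InfiniteCF of (nat -> nat).

(* Positions count from 0: [cf_digit e i] is the digit a_(i+1), and it is
   [None] past the end of a finite expansion. *)
Definition cf_digit (e : cf_expansion) (i : nat) : option nat :=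
  match e with
  | FiniteCF s => onth s i
  | InfiniteCF a => Some (a i)
  end.

(* The value of an infinite expansion is the limit of its convergents. The
   point 0 has the empty expansion. *)
Definition cf_expands (R : realType) (x : R) (e : cf_expansion) : Prop :=
  match e with
  | FiniteCF s =>
      [/\ forall a, a \in s -> (0 < a)%N,
          s <> [::] -> (1 < last 0 s)%N
        & cf_value R s = x]
  | InfiniteCF a =>
      (forall i, (0 < a i)%N) /\
      (fun n : nat => cf_value R (mkseq a n)) @ \oo --> x
  end.

(* I(s). Every point of [0, 1) has exactly one expansion, so the existential
   speaks of the expansion of x. *)
Definition cf_cylinder (R : realType) (s : seq nat) : set R :=
  [set x | 0 <= x < 1 /\
    exists2 e, cf_expands x e &
      forall i, (i < size s)%N -> cf_digit e i = Some (nth 0%N s i)].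

(* Measures on [0, 1] are rendered as measures on the Borel sets of R that
   only see the trace of a set on [0, 1]. *)
Definition gauss_kuzmin (R : realType) (A : set (measurableTypeR R)) : \bar R :=
  ((ln 2)^-1%:E *
   \int[@lebesgue_measure R]_(x in A `&` `[0%R, 1%R]%classic) ((1 + x)^-1)%:E)%E.

Definition has_continuous_density01 (R : realType)
    (mu : set (measurableTypeR R) -> \bar R) : Prop :=
  exists f : R -> R,
    [/\ {within `[0, 1]%classic, continuous f},
        forall x, 0 <= x <= 1 -> 0 <= f x
      & forall A : set (measurableTypeR R), measurable A ->
          mu A = (\int[@lebesgue_measure R]_(x in A `&` `[0%R, 1%R]%classic)
                    (f x)%:E)%E].

(* Main.v *)
(* Any perturbation of the Gauss-Kuzmin density that keeps the distribution
   function unchanged at the endpoints of the cylinders of length at most N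
   leaves the measure of these cylinders unchanged. Those endpoints are not
   dense: for some al < be none of them lies in ]al, be[, and we add to the
   Gauss-Kuzmin distribution function a small multiple of the C^1 bump
   max(0, (x - al)(be - x))^2. The reversal symmetry of the Gauss-Kuzmin
   measure itself is that of the continuant matrix under transposition. *)
Require Import Defs.
From HB Require Import structures.
From mathcomp Require Import all_boot all_order all_algebra.
From mathcomp Require Import all_classical all_reals all_analysis.
From mathcomp Require Import measurable_realfun ring lra.

Import Order.TTheory GRing.Theory Num.Theory.
Import numFieldNormedType.Exports.

Local Open Scope classical_set_scope.
Local Open Scope ring_scope.

Lemma onth_mkseq (T : Type) (a : nat -> T) n i :
  (i < n)%N -> onth (mkseq a n) i = Some (a i).
Proof.
by move=> i_n; rewrite onth_map onthE (nth_map 0%N) ?size_iota // nth_iota.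
Qed.

(** * Finite continued fractions as Moebius maps *)

Section continued_fractions.
Context {R : realType}.
Implicit Types (s t : seq nat) (x y z : R).

Definition cf_app s y : R := foldr (fun (a : nat) z => (a%:R + z)^-1) y s.

(* [cf_app s] is a Moebius map; this is its denominator. *)
Fixpoint cf_den s y : R :=
  if s is a :: s' then (a%:R + cf_app s' y) * cf_den s' y else 1.

Definition digits_pos s := forall a, a \in s -> (0 < a)%N.

Lemma digits_pos_cons a s :
  digits_pos (a :: s) -> 1 <= a%:R :> R /\ digits_pos s.
Proof.
move=> h; split; first by rewrite ler1n; apply: h; rewrite mem_head.
by move=> b bs; apply: h; rewrite inE bs orbT.
Qed.

Lemma cf_app_cat s t y : cf_app (s ++ t) y = cf_app s (cf_app t y).
Proof. exact: foldr_cat. Qed.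

Lemma cf_app_rcons s a y : cf_app (rcons s a) y = cf_app s (a%:R + y)^-1.
Proof. by rewrite -cats1 cf_app_cat. Qed.

Lemma cf_value_cat s t : cf_value R (s ++ t) = cf_app s (cf_value R t).
Proof. exact: cf_app_cat. Qed.

Lemma cf_app_itv s y : digits_pos s -> 0 <= y <= 1 -> 0 <= cf_app s y <= 1.
Proof.
elim: s => //= a s IH /digits_pos_cons[a1 sp] /(IH sp)/andP[y0 y1].
by rewrite invr_ge0 invf_le1; lra.
Qed.

Lemma cf_app_itvoo s y : digits_pos s -> 0 < y < 1 -> 0 < cf_app s y < 1.
Proof.
elim: s => //= a s IH /digits_pos_cons[a1 sp] /(IH sp)/andP[y0 y1].
by rewrite invr_gt0 invf_lt1; lra.
Qed.

Lemma cf_value_itv s : digits_pos s -> 0 <= cf_value R s <= 1.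
Proof. by move=> sp; apply: cf_app_itv => //; rewrite lexx ler01. Qed.

(* [cf_app s] is increasing or decreasing according to the parity of [size s];
   the sign of [(x - u) * (x - v)] expresses betweenness in both cases. *)
Lemma cf_app_between s y : digits_pos s -> 0 <= y <= 1 ->
  (cf_app s y - cf_app s 0) * (cf_app s y - cf_app s 1) <= 0.
Proof.
move=> + y01; elim: s => [|a s IH] /= => [_|/digits_pos_cons[a1 sp]].
  by move: y01; nra.
have /andP[u0 _] := cf_app_itv s y sp y01.
have /andP[v0 _] : 0 <= cf_app s 0 <= 1 by apply: cf_app_itv => //; lra.
have /andP[w0 _] : 0 <= cf_app s 1 <= 1 by apply: cf_app_itv => //; lra.
move: {IH}(IH sp) u0 v0 w0.
move: (cf_app s y) (cf_app s 0) (cf_app s 1) => u v w uvw u0 v0 w0.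
(* Taking reciprocals flips the sign of both differences, so their product only picks up a positive
   factor. *)
rewrite (_ : _ * _ = ((u - v) * (u - w)) *
    ((a%:R + u) ^+ 2 * (a%:R + v) * (a%:R + w))^-1); last first.
  by field; rewrite !gt_eqF //; lra.
by rewrite mulr_le0_ge0 // invr_ge0 !mulr_ge0 ?sqr_ge0 //; lra.
Qed.

(** Undoing the outermost digit by [x^-1 - a%:R] preserves strict betweenness, so induction reaches
    the empty string. Strictness keeps [y] away from 0 and 1, where the digits of [cf_app s y] need
    not begin with [s]. *)
Lemma cf_app_surj s x : digits_pos s ->
  (x - cf_app s 0) * (x - cf_app s 1) < 0 ->
  exists2 y, 0 < y < 1 & cf_app s y = x.
Proof.
elim: s x => [|a s IH] x /= => [_ h|/digits_pos_cons[a1 sp]].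
  by exists x => //; apply/andP; split; nra.
have /andP[v0 _] : 0 <= cf_app s 0 <= 1 by apply: cf_app_itv => //; lra.
have /andP[w0 _] : 0 <= cf_app s 1 <= 1 by apply: cf_app_itv => //; lra.
move: {IH}(IH (x^-1 - a%:R) sp) v0 w0.
move: (cf_app s) => f IH v0 w0 h.
have vi : 0 < (a%:R + f 0)^-1 by rewrite invr_gt0; lra.
have wi : 0 < (a%:R + f 1)^-1 by rewrite invr_gt0; lra.
have x0 : 0 < x by nra.
have [|y y01 fy] := IH; last by exists y => //; rewrite fy addrC subrK invrK.
have -> : (x^-1 - a%:R - f 0) * (x^-1 - a%:R - f 1) =
    ((x - (a%:R + f 0)^-1) * (x - (a%:R + f 1)^-1)) *
    ((a%:R + f 0) * (a%:R + f 1) / x ^+ 2).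
  by field; rewrite !gt_eqF //; lra.
by rewrite nmulr_rlt0 // divr_gt0 ?exprn_gt0 // mulr_gt0 //; lra.
Qed.

Lemma cf_den_ge s y : digits_pos s -> 0 <= y <= 1 ->
  1 <= cf_den s y /\ (size s)%:R <= cf_den s y.
Proof.
(* The extra third bound drives the induction: for nonempty [s], the product
   [cf_app s y * cf_den s y] is the denominator of the tail of [s], so each new digit adds at least
   1. *)
move=> + y01; suff: digits_pos s -> [/\ 1 <= cf_den s y,
    (size s)%:R <= cf_den s y & s <> [::] -> 1 <= cf_app s y * cf_den s y].
  by move=> h /h[].
elim: s => [//|a s IH /digits_pos_cons[a1 sp]] /=.
have [d1 ds dn] := IH sp; have /andP[u0 _] := cf_app_itv s y sp y01.
split.
- by move: d1 u0 a1; nra.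
- rewrite -natr1; move: (cf_den s y) (cf_app s y) d1 ds u0 dn => D c d1 ds u0.
  have aD : 0 <= (a%:R - 1) * D by apply: mulr_ge0; lra.
  case: s {IH sp} ds => [|b s] ds dn; first by rewrite /= add0r; nra.
  have : 1 <= c * D by exact: dn.
  by lra.
- move=> _; rewrite mulrA mulVf ?mul1r // gt_eqF //; lra.
Qed.

(** This is the determinant identity: the matrix of [cf_app s] has determinant 1 or -1. *)
Lemma cf_app_dist s y z : digits_pos s -> 0 <= y <= 1 -> 0 <= z <= 1 ->
  `|cf_app s y - cf_app s z| = `|y - z| / (cf_den s y * cf_den s z).
Proof.
move=> + y01 z01; elim: s => [_|a s IH /digits_pos_cons[a1 sp]] /=.
  by rewrite mulr1 divr1.
have /andP[u0 _] := cf_app_itv s y sp y01.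
have /andP[v0 _] := cf_app_itv s z sp z01.
have [+ _] := cf_den_ge s y sp y01; have [+ _] := cf_den_ge s z sp z01.
move: (cf_app s y) (cf_app s z) (cf_den s y) (cf_den s z) u0 v0 (IH sp).
move=> u v D E u0 v0 uv E1 D1.
have -> : (a%:R + u)^-1 - (a%:R + v)^-1 =
    - (u - v) / ((a%:R + u) * (a%:R + v)).
  by field; rewrite !gt_eqF //; lra.
rewrite normrM normrN uv normfV [`|_ * (a%:R + v)|]ger0_norm; last first.
  by apply: mulr_ge0; lra.
by field; rewrite !gt_eqF //; lra.
Qed.

Lemma cf_app_dist_le s y z : digits_pos s -> 0 <= y <= 1 -> 0 <= z <= 1 ->
  (size s)%:R * `|cf_app s y - cf_app s z| <= 1.
Proof.
move=> sp y01 z01; rewrite cf_app_dist //.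
have [D1 _] := cf_den_ge s y sp y01; have [E1 Es] := cf_den_ge s z sp z01.
have n1 : `|y - z| <= 1 by rewrite ler_norml; lra.
rewrite mulrA ler_pdivrMr ?mul1r; last by nra.
apply: (le_trans (y := (size s)%:R)); first by apply: ler_piMr.
by nra.
Qed.

(* If [cf_app s y = (p + p' y) / (q + q' y)], the right-hand side is
   [q + q' y + p z + p' y z], and reversal transposes the matrix
   [[p', p], [q', q]], a product of symmetric matrices. *)
Lemma cf_den_rev s y z : digits_pos s -> 0 <= y -> 0 <= z ->
  cf_den (rev s) z * (1 + y * cf_app (rev s) z)
  = cf_den s y * (1 + z * cf_app s y).
Proof.
have ge0 t x : 0 <= x -> 0 <= cf_app t x.
  by move=> x0; elim: t => //= a t IH; rewrite invr_ge0 addr_ge0.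
have rconsE t a x :
    cf_den (rcons t a) x = (a%:R + x) * cf_den t (a%:R + x)^-1.
  by elim: t => //= b t IH; rewrite IH cf_app_rcons; ring.
move=> sp; elim: s sp y z => [|a s IH] => [_ y z _ _|].
  by rewrite /= /rev /= !mul1r mulrC.
move=> h y z y0 z0; have [a1 sp] := digits_pos_cons _ _ h.
have zi : 0 <= (a%:R + z)^-1 by rewrite invr_ge0; lra.
(* The last digit of the reversed string is absorbed into the argument: the induction hypothesis is
   used at [(a%:R + z)^-1]. *)
rewrite rev_cons rconsE cf_app_rcons -mulrA IH //=.
have u0 := ge0 s y y0.
by field; rewrite !gt_eqF //; lra.
Qed.

(** Follows from [cf_den_rev] at the four pairs of arguments in {0, 1}. Up to sign, the logarithm of
    this ratio is [ln 2] times the Gauss-Kuzmin measure of the cylinder. *)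
Lemma cf_endpoints_ratio_rev s : digits_pos s ->
  (1 + cf_app s 1) / (1 + cf_app s 0)
  = (1 + cf_app (rev s) 1) / (1 + cf_app (rev s) 0).
Proof.
move=> sp; have rp : digits_pos (rev s).
  by move=> a; rewrite mem_rev; exact: sp.
have i0 : (0 : R) <= (0 : R) <= 1 by lra.
have i1 : (0 : R) <= (1 : R) <= 1 by lra.
have [p0 _] := cf_den_ge s 0 sp i0; have [p1 _] := cf_den_ge s 1 sp i1.
have [q0 _] := cf_den_ge _ 0 rp i0; have [q1 _] := cf_den_ge _ 1 rp i1.
have /andP[u0 _] := cf_app_itv s 0 sp i0.
have /andP[u1 _] := cf_app_itv s 1 sp i1.
have /andP[v0 _] := cf_app_itv _ 0 rp i0.
have /andP[v1 _] := cf_app_itv _ 1 rp i1.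
have := cf_den_rev s 1 1 sp ler01 ler01.
have := cf_den_rev s 0 0 sp (lexx _) (lexx _).
have := cf_den_rev s 1 0 sp ler01 (lexx _).
have := cf_den_rev s 0 1 sp (lexx _) ler01.
rewrite !mul0r !mul1r !addr0 !mulr1.
move: (cf_den s 0) (cf_den s 1) (cf_den (rev s) 0) (cf_den (rev s) 1)
  (cf_app s 0) (cf_app s 1) (cf_app (rev s) 0) (cf_app (rev s) 1)
  p0 p1 q0 q1 u0 u1 v0 v1
  => D0 D1 E0 E1 a b c d p0 p1 q0 q1 u0 u1 v0 v1 e01 e10 e00 e11.
have an : 1 + a != 0 by rewrite gt_eqF //; lra.
have cn : 1 + c != 0 by rewrite gt_eqF //; lra.
apply/eqP; rewrite eqr_div //; apply/eqP.
have Dp : D0 * D1 != 0 by rewrite mulf_neq0 // gt_eqF //; lra.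
apply/(mulfI Dp).
transitivity ((D1 * (1 + b)) * (D0 * (1 + c))); first by ring.
by rewrite -e11 -[in X in _ * X]e00 e10 e01; ring.
Qed.

(** * The Gauss map and the existence of expansions *)

Definition gauss_digit x : nat := Num.truncn x^-1.
Definition gauss_map x : R := x^-1 - (gauss_digit x)%:R.

(** The point 0 is included: the convention [0^-1 = 0] makes it a fixed point of [gauss_map], with
    digit 0. *)
Lemma gauss_map_itv x : 0 <= x -> 0 <= gauss_map x < 1.
Proof.
rewrite -invr_ge0 => /truncn_itv; rewrite /gauss_map /gauss_digit -natr1.
by lra.
Qed.

Lemma gauss_digit_gt0 x : 0 < x < 1 -> (0 < gauss_digit x)%N.
Proof.
by move=> /andP[x0 x1]; rewrite truncn_gt0 invf_ge1 ?ltW.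
Qed.

Lemma gauss_iter_itv n x : 0 <= x < 1 -> 0 <= iter n gauss_map x < 1.
Proof. by elim: n => //= n IH /IH/andP[h _]; exact: gauss_map_itv. Qed.

Lemma gauss_iterE n x :
  cf_app (mkseq (fun i => gauss_digit (iter i gauss_map x)) n)
    (iter n gauss_map x) = x.
Proof.
elim: n => // n IH; rewrite mkseqS cf_app_rcons iterS {1}/gauss_map.
by rewrite addrC subrK invrK.
Qed.

Lemma gauss_map_add (a : nat) y : 0 < y < 1 ->
  gauss_digit (a%:R + y)^-1 = a /\ gauss_map (a%:R + y)^-1 = y.
Proof.
move=> y01; have e : gauss_digit (a%:R + y)^-1 = a.
  by apply: truncn_def; rewrite invrK -natr1; lra.
by rewrite /gauss_map e invrK addrC addKr.
Qed.

Lemma gauss_iter_cf_app s y : digits_pos s -> 0 < y < 1 ->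
  forall i, (i < size s)%N ->
    0 < iter i gauss_map (cf_app s y) < 1 /\
    gauss_digit (iter i gauss_map (cf_app s y)) = nth 0%N s i.
Proof.
elim: s => [//|a s IH] h y01; have [a1 sp] := digits_pos_cons _ _ h.
have [d m] := gauss_map_add a _ (cf_app_itvoo s y sp y01).
case=> [_|i /=]; last by rewrite ltnS -iterS iterSr m; exact: IH.
by split; [exact: (cf_app_itvoo (a :: s))|].
Qed.

(** By [gauss_iterE], [x] and its n-th convergent are the images of [iter n gauss_map x] and 0 under
    the same Moebius map, hence at distance at most 1/n. *)
Lemma gauss_convergents_cvg x : 0 <= x < 1 ->
  (forall n, 0 < iter n gauss_map x) ->
  (fun n : nat =>
     cf_value R (mkseq (fun i => gauss_digit (iter i gauss_map x)) n))
  @ \oo --> x.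
Proof.
move=> x01 xn; pose a i := gauss_digit (iter i gauss_map x).
rewrite -[X in fun n => cf_value R (mkseq X n)]/a.
have ap n : digits_pos (mkseq a n).
  move=> _ /mapP[i _ ->]; apply: gauss_digit_gt0; rewrite xn /=.
  by have /andP[] := gauss_iter_itv i x x01.
apply/cvgrPdist_le => e e0; near=> n.
have n0 : 0 < n%:R :> R by rewrite ltr0n; near: n; exact: nbhs_infty_gt.
have /andP[z0 z1] := gauss_iter_itv n x x01.
have := cf_app_dist_le (mkseq a n) (iter n gauss_map x) 0 (ap n).
rewrite gauss_iterE size_mkseq lexx ler01 z0 (ltW z1) => /(_ isT isT).
rewrite mulrC -ler_pdivlMr // mul1r => /le_trans; apply.
rewrite invf_ple ?posrE //; near: n; exact: nbhs_infty_ger.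
Unshelve. all: by end_near. Qed.

(** The expansion is infinite if the orbit of [x] avoids 0, and otherwise stops at the first zero;
    the positivity condition says that position [n] comes before that stop. *)
Lemma cf_expansion_exists x : 0 <= x < 1 ->
  exists2 e, cf_expands x e &
    forall n, (forall i, (i <= n)%N -> 0 < iter i gauss_map x) ->
      cf_digit e n = Some (gauss_digit (iter n gauss_map x)).
Proof.
move=> x01; pose a i := gauss_digit (iter i gauss_map x).
have ap i : 0 < iter i gauss_map x -> (0 < a i)%N.
  move=> xi; apply: gauss_digit_gt0; rewrite xi /=.
  by have /andP[] := gauss_iter_itv i x x01.
have [xn|] := pselect (forall n, 0 < iter n gauss_map x).
  exists (InfiniteCF a) => //; split; last exact: gauss_convergents_cvg.
  by move=> i; exact: ap.
move=> /existsNP[m0 /negP m0P].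
have exm : exists m, ~~ (0 < iter m gauss_map x) by exists m0.
have [m mP mmin] := ex_minnP exm.
have zm : iter m gauss_map x = 0.
  move: mP; have /andP[h _] := gauss_iter_itv m x x01.
  by rewrite lt_def h andbT negbK => /eqP.
have lt_m i : (i < m)%N -> 0 < iter i gauss_map x.
  by move=> im; apply: contraTT im => /mmin; rewrite -leqNgt.
exists (FiniteCF (mkseq a m)); last first.
  move=> n nP; rewrite /cf_digit.
  have nm : (n < m)%N by rewrite ltnNge; apply: contra mP => /nP.
  exact: onth_mkseq.
split.
- by move=> _ /mapP[i + ->]; rewrite mem_iota => /andP[_ /lt_m]; exact: ap.
(* The orbit reaches 0 only after a point that is the inverse of its digit; that point lies strictly
   between 0 and 1, so the last digit exceeds 1. *)
- case: m {mP mmin} zm lt_m => // m zm lt_m _.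
  rewrite mkseqS last_rcons -(ltr_nat R).
  have := lt_m m (ltnSn m); have /andP[_] := gauss_iter_itv m x x01.
  move: zm; rewrite iterS => /subr0_eq; rewrite -/(a m) => <- z1 z0.
  by rewrite invf_gt1.
- by rewrite -[RHS](gauss_iterE m) zm.
Qed.

(** * Cylinders and their endpoints *)

Lemma cf_value_prefix_between s t : digits_pos t ->
  (forall i, (i < size s)%N -> onth t i = Some (nth 0%N s i)) ->
  (cf_value R t - cf_app s 0) * (cf_value R t - cf_app s 1) <= 0.
Proof.
move=> tp st; have le_st : (size s <= size t)%N.
  rewrite leqNgt; apply/negP => lt_ts.
  by have := st _ lt_ts; rewrite onth_default.
have ts : take (size s) t = s.
  apply: (@eq_from_nth _ 0%N) => [|i]; rewrite size_takel // => i_s.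
  by rewrite nth_take //; apply: onth_nth; exact: st.
(* The remaining digits form a fraction in [0, 1]. It may equal 1, because [t] may be a truncated
   infinite expansion ending in 1. *)
rewrite -(cat_take_drop (size s) t) ts cf_value_cat.
apply: cf_app_between.
  by move=> a; rewrite -{1}ts => /mem_take; exact: tp.
by apply: cf_value_itv => a /mem_drop; exact: tp.
Qed.

Lemma cf_cylinder_between s x : cf_cylinder s x ->
  (x - cf_app s 0) * (x - cf_app s 1) <= 0.
Proof.
move=> [_ [[t|a] /= xe es]].
  by case: xe => tp _ <-; exact: cf_value_prefix_between.
have {xe} [ap ax] := xe.
(* Weak betweenness is a closed condition, so it passes from the convergents to their limit. *)
have h : (cf_value R (mkseq a n) - cf_app s 0) *
         (cf_value R (mkseq a n) - cf_app s 1) @[n --> \oo]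
    --> (x - cf_app s 0) * (x - cf_app s 1).
  by apply: cvgM; apply: cvgB => //; exact: cvg_cst.
rewrite -(cvg_lim _ h) //; apply: limr_le; first exact: cvgP h.
near=> n; apply: cf_value_prefix_between.
  by move=> _ /mapP[i _ ->].
move=> i i_s; rewrite onth_mkseq ?es //; apply: leq_trans i_s _.
by near: n; exact: nbhs_infty_ge.
Unshelve. all: by end_near. Qed.

(** With [cf_cylinder_between], this traps the cylinder between an open interval and its closure,
    which determines its measure under any density. *)
Lemma between_cf_cylinder s x : digits_pos s ->
  (x - cf_app s 0) * (x - cf_app s 1) < 0 -> cf_cylinder s x.
Proof.
move=> sp /(cf_app_surj s x sp)[y y01 <-].
have x01 : 0 <= cf_app s y < 1.
  by have /andP[/ltW -> ->] := cf_app_itvoo s y sp y01.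
split=> //; have [e xe ed] := cf_expansion_exists _ x01.
exists e => // i i_s; have gi := gauss_iter_cf_app s y sp y01.
rewrite ed; first by have [_ ->] := gi i i_s.
by move=> j /leq_ltn_trans/(_ i_s)/gi[/andP[]].
Qed.

Lemma cf_endpoints_gap N : exists al be : R,
  [/\ 0 <= al, al < be, be <= 1 &
    forall s y, digits_pos s -> (size s <= N)%N -> y = 0 \/ y = 1 ->
      ~~ (al < cf_app s y < be)].
Proof.
elim: N => [|N [al [be [al0 ab be1 gap]]]].
  by exists 0, 1; split=> // -[] //= y _ _ []->; rewrite ?ltxx ?andbF.
(* Image of the previous interval under [y |-> 1 / (1 + y)]: only the digit 1
   can lead into it. *)
exists (1 + be)^-1, (1 + al)^-1; split.
- by rewrite invr_ge0; lra.
- by rewrite ltf_pV2 ?posrE; lra.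
- by rewrite invf_le1; lra.
move=> [|a s] y sp; rewrite /= ?ltnS => sN y01.
  have h : 0 < (1 + be)^-1 by rewrite invr_gt0; lra.
  have h1 : (1 + al)^-1 <= 1 by rewrite invf_le1; lra.
  by apply/negP => ?; case: y01 => ?; lra.
have [a1 {}sp] := digits_pos_cons _ _ sp.
have /andP[u0 u1] : 0 <= cf_app s y <= 1.
  by apply: cf_app_itv => //; case: y01 => ->; lra.
have {gap} := gap s y sp sN y01; apply: contra.
rewrite !ltf_pV2 ?posrE; try lra.
(* The digit 0 contradicts [a1]; the digit 1 leads back to the previous gap; a larger digit makes
   the denominator at least 2, hence at least [1 + be]. *)
case: a a1 => [|[|a]] a1; [by lra|by lra|].
have : 0 <= a%:R :> R by [].
rewrite -!natr1; lra.
Qed.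

End continued_fractions.

(** * Probability measures on [0, 1] given by a continuous density *)

Section density01.
Context {R : realType} (f F : R -> R).
Context (f_cont : continuous f) (f_ge0 : forall x, 0 <= f x).
Context (F_derive : forall x : R, 0 <= x -> is_derive x 1 F (f x)).
Context (F01 : F 1 - F 0 = 1).

Definition density01_prob (A : set (measurableTypeR R)) : \bar R :=
  (\int[@lebesgue_measure R]_(x in A `&` `[0%R, 1%R]%classic) (f x)%:E)%E.

Lemma integral_density01 (u v : R) : 0 <= u <= v ->
  (\int[@lebesgue_measure R]_(x in `[u, v]) (f x)%:E)%E = (F v - F u)%:E.
Proof.
move=> /andP[u0]; rewrite le_eqVlt => /predU1P[<-|uv].
  by rewrite set_itv1 integral_set1 subrr.
have cF x : 0 <= x -> {for x, continuous F}.
  move=> /F_derive dF; apply: differentiable_continuous.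
  by apply/derivable1_diffP; exact: ex_derive.
rewrite (@continuous_FTC2 _ f F) //.
- exact: continuous_subspaceT.
- split.
  + move=> x /[!in_itv]/= /andP[ux _].
    have dF : is_derive x 1 F (f x) by apply: F_derive; lra.
    exact: ex_derive.
  + by apply/cvg_at_right_filter/cF.
  + by apply/cvg_at_left_filter/cF; lra.
- move=> x /[!in_itv]/= /andP[ux _].
  have dF : is_derive x 1 F (f x) by apply: F_derive; lra.
  by rewrite derive1E derive_val.
Qed.

(** Extending the density by 0 outside [0, 1] turns the integral over a trace into one over the set
    itself, the form required for sigma-additivity. *)
Let f01 := (EFin \o f) \_ `[0%R, 1%R]%classic.

Let measurable_f : measurable_fun setT f.
Proof. exact: continuous_measurable_fun. Qed.

Let density01_probE A :
  density01_prob A = (\int[@lebesgue_measure R]_(x in A) f01 x)%E.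
Proof. exact: integral_mkcondr. Qed.

Let f01_ge0 x : (0 <= f01 x)%E.
Proof. by apply: erestrict_ge0 => y _ /=; rewrite lee_fin. Qed.

Let density01_prob0 : density01_prob set0 = 0%E.
Proof. by rewrite density01_probE integral_set0. Qed.

Let density01_prob_ge0 A : (0 <= density01_prob A)%E.
Proof. by rewrite density01_probE integral_ge0. Qed.

Let density01_prob_sigma_additive : semi_sigma_additive density01_prob.
Proof.
rewrite (_ : density01_prob =
  fun A => (\int[@lebesgue_measure R]_(x in A) f01 x)%E); last first.
  by apply/funext => A; exact: density01_probE.
apply: semi_sigma_additive_nng_induced => //.
apply/(measurable_restrictT _ _).1 => //; apply: measurable_funTS.
exact/measurable_EFinP.
Qed.

HB.instance Definition _ := isMeasure.Build _ _ _ density01_prob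
  density01_prob0 density01_prob_ge0 density01_prob_sigma_additive.

Let density01_probT : density01_prob [set: _] = 1%E.
Proof.
by rewrite /density01_prob setTI integral_density01 ?F01 // lexx ler01.
Qed.

HB.instance Definition _ :=
  @Measure_isProbability.Build _ _ R density01_prob density01_probT.

Definition density01_probability : probability (measurableTypeR R) R :=
  density01_prob.

Lemma density01_prob_itv (u v : R) (b0 b1 : bool) : 0 <= u <= v -> v <= 1 ->
  density01_prob [set` Interval (BSide b0 u) (BSide b1 v)] = (F v - F u)%:E.
Proof.
move=> uv v1; rewrite /density01_prob setIidl.
  rewrite integral_itv_bndoo; last first.
    by apply/measurable_EFinP/measurable_funTS.
  rewrite -(@integral_itv_bndoo _ _ _ _ true false); last first.
    by apply/measurable_EFinP/measurable_funTS.
  exact: integral_density01.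
apply: subset_itvScc; rewrite bnd_simp; lra.
Qed.

(** [A] is the open interval plus a subset of its two endpoints; this gives measurability, and
    monotonicity then gives the value. *)
Lemma density01_prob_sandwich (u v : R) (A : set (measurableTypeR R)) :
  0 <= u <= v -> v <= 1 -> `]u, v[ `<=` A -> A `<=` `[u, v] ->
  density01_prob A = (F v - F u)%:E.
Proof.
move=> uv v1 uA Av; have mA : measurable A.
  have mA1 x : measurable (A `&` [set x]).
    by have [->|->] := subset_set1 (@subIsetr _ A [set x]).
  have -> : A = `]u, v[ `|` (A `&` [set u] `|` A `&` [set v]).
    rewrite -setIUr; apply/seteqP; split=> [x Ax|x [/uA|[]]] //.
    have := Av x Ax; rewrite /= !in_itv /= !le_eqVlt => /andP[].
    move=> /predU1P[ux _|ux /predU1P[xv|xv]].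
    - by right => /=; split=> //; left.
    - by right => /=; split=> //; right.
    - by left; rewrite ux.
  by apply: measurableU => //; exact: measurableU.
apply/eqP; rewrite eq_le; apply/andP; split.
  rewrite -(density01_prob_itv u v true false) //.
  by apply: le_measure; rewrite ?inE.
rewrite -(density01_prob_itv u v false true) //.
by apply: le_measure; rewrite ?inE.
Qed.

End density01.

(** * Betweenness as a sign condition, and the positive part of a real *)

Section interval_sign.
Context {R : realFieldType}.

Lemma itvoo_mul_lt0 (u v x : R) : u < x < v -> (x - u) * (x - v) < 0.
Proof. by move=> ?; nra. Qed.

Lemma mul_le0_itvcc (u v x : R) : u <= v ->
  (x - u) * (x - v) <= 0 -> u <= x <= v.
Proof. by move=> ? ?; apply/andP; split; nra. Qed.

End interval_sign.

Section max0.
Context {R : realType}.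

Lemma continuous_max0 : continuous (fun t : R => Num.max 0 t).
Proof.
move=> t; apply/cvgrPdist_le => e e0; near=> s.
apply: (@le_trans _ _ `|t - s|); last first.
  by near: s; exact: cvgr_dist_le.
by case: (ltrP 0 t) => ?; case: (ltrP 0 s) => ?; rewrite ler_norml;
  case: (ger0P (t - s)); lra.
Unshelve. all: by end_near. Qed.

(** Squaring removes the kink at 0: the first-order remainder is at most [h ^+ 2] in absolute value,
    so the difference quotient is within [|h|] of the claimed derivative. *)
Lemma is_derive_sqr_max0 (t : R) :
  is_derive t 1 (fun t : R => Num.max 0 t ^+ 2) (2 * Num.max 0 t).
Proof.
have h : h^-1 *: (((fun t : R => Num.max 0 t ^+ 2) \o shift t) (h *: 1) -
    Num.max 0 t ^+ 2) @[h --> (0:R)^'] --> 2 * Num.max 0 t.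
  apply/cvgrPdist_le => e e0; near=> h.
  have h0 : h != 0 by near: h; exact: nbhs_dnbhs_neq.
  have he : `|h| <= e by near: h; exact: dnbhs0_le.
  apply: le_trans he => /=; rewrite scaler1 /GRing.scale /=.
  have -> : 2 * Num.max 0 t - h^-1 * (Num.max 0 (h + t) ^+ 2 - Num.max 0 t ^+ 2)
      = - ((Num.max 0 (h + t) ^+ 2 - Num.max 0 t ^+ 2
            - 2 * Num.max 0 t * h) / h).
    by field.
  rewrite normrN normrM normfV ler_pdivrMr ?normr_gt0 // -normrM -expr2.
  rewrite [leRHS]ger0_norm ?sqr_ge0 //.
  by case: (ltrP 0 t) => ?; case: (ltrP 0 (h + t)) => ?; rewrite ler_norml; nra.
apply: DeriveDef; first exact: cvgP h.
exact: cvg_lim h.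
Unshelve. all: by end_near. Qed.

End max0.

(** * The perturbed Gauss-Kuzmin measure *)

Section perturbed_gauss_kuzmin.
Context {R : realType}.

Lemma continuous_inv1Dnorm : continuous (fun x : R => (1 + `|x|)^-1).
Proof.
move=> x; apply: cvgV; first by rewrite gt_eqF // ltr_pwDl.
by apply: cvgD; [exact: cvg_cst | exact: norm_continuous].
Qed.

Lemma is_derive_ln1D (x : R) : 0 <= x ->
  is_derive x 1 (fun x : R => ln (1 + x)) (1 + `|x|)^-1.
Proof.
move=> x0; have x1 : 0 < 1 + x by lra.
have dln := is_derive1_ln x1.
have d1 : is_derive x 1 (fun x : R => 1 + x) 1.
  have := is_deriveD (is_derive_cst (1 : R) x 1) (is_derive_id x 1).
  by rewrite add0r.
by have := is_derive1_comp dln d1; rewrite mulr1 ger0_norm.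
Qed.

Lemma gauss_kuzmin_itv0 (m : R) : 0 <= m <= 1 ->
  @gauss_kuzmin R `[0, m] = ((ln 2)^-1 * ln (1 + m))%:E.
Proof.
move=> /andP[m0 m1]; rewrite /gauss_kuzmin setIidl; last first.
  by apply: subset_itvScc; rewrite bnd_simp.
have := integral_density01 _ _ continuous_inv1Dnorm is_derive_ln1D 0 m.
rewrite lexx m0 addr0 ln1 subr0 EFinM => /(_ isT) <-; congr (_ * _)%E.
apply: eq_integral => x /[!inE]/=; rewrite in_itv /= => /andP[x0 _].
by rewrite ger0_norm.
Qed.

Context (al be : R).
Context (al_ge0 : 0 <= al) (al_be : al < be) (be_le1 : be <= 1).

Definition bump (x : R) := Num.max 0 ((x - al) * (be - x)).

(* The absolute value makes the density continuous and nonnegative on all of R,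
   and the derivative of the bump is at least -4. *)
Definition pgk_density (x : R) :=
  (ln 2)^-1 * (1 + `|x|)^-1 + 16^-1 * (2 * bump x * (al + be - 2 * x)).

Definition pgk_cdf (x : R) := (ln 2)^-1 * ln (1 + x) + 16^-1 * bump x ^+ 2.

Lemma bump_eq0 x : ~~ (al < x < be) -> bump x = 0.
Proof.
have ab := al_be; rewrite negb_and -!leNgt => /orP[] ?.
  by apply/max_idPl; nra.
by apply/max_idPl; nra.
Qed.

Lemma continuous_pgk_density : continuous pgk_density.
Proof.
have cb : continuous bump.
  move=> x; apply: (@continuous_comp _ _ _ (fun x => (x - al) * (be - x))).
    apply: cvgM; apply: cvgB; (exact: cvg_cst || exact: cvg_id).
  exact: continuous_max0.
move=> x; apply: cvgD; apply: cvgM.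
- exact: cvg_cst.
- exact: continuous_inv1Dnorm.
- exact: cvg_cst.
- apply: cvgM; first by apply: cvgM; [exact: cvg_cst | exact: cb].
  apply: cvgB; first exact: cvg_cst.
  by apply: cvgM; [exact: cvg_cst | exact: cvg_id].
Qed.

Lemma ln2_itv : 0 < ln (2 : R) <= 1.
Proof.
rewrite ln_gt0 ?ltr1n //=.
by rewrite (_ : 2 = 1 + 1 :> R) ?le_ln1Dx //; lra.
Qed.

Lemma pgk_density_ge0 x : 0 <= pgk_density x.
Proof.
have /andP[l0 l1] := ln2_itv.
rewrite /pgk_density; have [/andP[ax xb]|/bump_eq0->] := boolP (al < x < be).
  have i1 : 1 <= (ln (2 : R))^-1 by rewrite invf_ge1.
  have b1 := be_le1; have a0 := al_ge0.
  have i2 : 2^-1 <= (1 + `|x|)^-1.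
    by rewrite ger0_norm ?lef_pV2 ?posrE; lra.
  have p0 : 0 <= bump x by rewrite le_max lexx.
  have p1 : bump x <= 1 by rewrite ge_max; nra.
  have : 2^-1 <= (ln (2 : R))^-1 * (1 + `|x|)^-1 by nra.
  (* As [bump x <= 1], the unscaled perturbation is at least -4; the factor 1/16 reduces this to
     -1/4, against a Gauss-Kuzmin density of at least 1/2. *)
  have : 0 <= bump x * (al + be - 2 * x + 2) by apply: mulr_ge0; lra.
  by nra.
by rewrite mulr0 mul0r mulr0 addr0 mulr_ge0 ?invr_ge0 ?ltW // ltr_pwDl.
Qed.

Lemma is_derive_pgk_cdf (x : R) : 0 <= x ->
  is_derive x 1 pgk_cdf (pgk_density x).
Proof.
move=> x0; have dln := is_derive_ln1D x x0.
have dp : is_derive x 1 (fun x : R => (x - al) * (be - x)) (al + be - 2 * x).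
  have h1 := is_deriveB (is_derive_id x (1 : R)) (is_derive_cst al x (1 : R)).
  have h2 := is_deriveB (is_derive_cst be x (1 : R)) (is_derive_id x (1 : R)).
  apply: (is_derive_eq (is_deriveM h1 h2)).
  by rewrite !fctE /GRing.scale /=; ring.
have db := is_derive1_comp (is_derive_sqr_max0 _) dp.
exact: (is_deriveD (is_deriveZ (ln 2)^-1 dln) (is_deriveZ 16^-1 db)).
Qed.

Lemma pgk_cdf01 : pgk_cdf 1 - pgk_cdf 0 = 1.
Proof.
have /andP[l0 l1] := ln2_itv; have a0 := al_ge0; have b1 := be_le1.
rewrite /pgk_cdf !bump_eq0; try by apply/negP; lra.
by rewrite expr0n /= mulr0 !addr0 ln1 mulr0 subr0 mulVf // gt_eqF.
Qed.

Definition pgk : probability (measurableTypeR R) R :=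
  density01_probability _ _ continuous_pgk_density pgk_density_ge0
    is_derive_pgk_cdf pgk_cdf01.

Lemma pgk_itv0 (m : R) : 0 <= m <= 1 ->
  pgk `[0, m]%classic = (pgk_cdf m - pgk_cdf 0)%:E.
Proof.
move=> m01; apply: density01_prob_itv.
- exact: continuous_pgk_density.
- exact: is_derive_pgk_cdf.
- by rewrite lexx; case/andP: m01.
- by case/andP: m01.
Qed.

(** The initial segment ending at the midpoint [m] of the gap separates the measures: they differ
    there by [16^-1 * bump m ^+ 2]. *)
Lemma pgk_neq_gauss_kuzmin :
  ~ (forall A : set (measurableTypeR R), measurable A ->
       pgk A = gauss_kuzmin A).
Proof.
have a0 := al_ge0; have ab := al_be; have b1 := be_le1.
pose m := (al + be) / 2.
have m01 : 0 <= m <= 1 by rewrite /m; lra.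
move=> /(_ `[0, m]%classic (measurable_itv _)).
rewrite pgk_itv0 // gauss_kuzmin_itv0 // => -[].
rewrite /pgk_cdf (bump_eq0 0); last by apply/negP; lra.
rewrite expr0n /= mulr0 addr0 addr0 ln1 mulr0 subr0.
have : 0 < bump m by rewrite lt_max; apply/orP; right; rewrite /m; nra.
by move=> /(exprn_gt0 2); lra.
Qed.

(** The bump vanishes at both endpoints, so the increment of [pgk_cdf] is the Gauss-Kuzmin one. It
    is written through the ratio that reversal preserves. *)
Lemma pgk_cf_cylinder s : digits_pos s ->
  (forall y : R, y = 0 \/ y = 1 -> ~~ (al < cf_app s y < be)) ->
  pgk (cf_cylinder s) =
  ((ln 2)^-1 * `|ln ((1 + cf_app s 1) / (1 + cf_app s 0))|)%:E.
Proof.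
move=> sp gap.
have i0 : (0 : R) <= (0 : R) <= 1 by lra.
have i1 : (0 : R) <= (1 : R) <= 1 by lra.
have := bump_eq0 _ (gap 0 (or_introl erefl)).
have := bump_eq0 _ (gap 1 (or_intror erefl)).
have := cf_app_itv s 0 sp i0; have := cf_app_itv s 1 sp i1.
have := @between_cf_cylinder R s ^~ sp; have := @cf_cylinder_between R s.
move: (cf_app s 0) (cf_app s 1) (cf_cylinder s) => u v A Auv uvA v01 u01 bv bu.
have cdfB x y : 0 <= x -> 0 <= y -> x <= y -> bump x = 0 -> bump y = 0 ->
    pgk_cdf y - pgk_cdf x = (ln 2)^-1 * `|ln (1 + y) - ln (1 + x)|.
  move=> x0 y0 xy bx bxy; rewrite /pgk_cdf bx bxy ger0_norm; first by ring.
  by rewrite subr_ge0 ler_ln ?posrE; lra.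
have pgkE x y : 0 <= x <= y -> y <= 1 -> `]x, y[ `<=` A -> A `<=` `[x, y] ->
    pgk A = (pgk_cdf y - pgk_cdf x)%:E.
  apply: density01_prob_sandwich.
  - exact: continuous_pgk_density.
  - exact: pgk_density_ge0.
  - exact: is_derive_pgk_cdf.
have /andP[u0 u1] := u01; have /andP[v0 v1] := v01.
rewrite ln_div ?posrE ?ltr_pwDl //.
(* The order of the endpoints depends on the parity of the length of [s]; the absolute value makes
   both cases agree. *)
have [uv|/ltW vu] := lerP u v.
- rewrite -cdfB //; apply: pgkE => [||x /=|x /Auv].
  + by rewrite u0.
  + by [].
  + by rewrite in_itv => /itvoo_mul_lt0; exact: uvA.
  + by rewrite /= in_itv; exact: mul_le0_itvcc.
- rewrite distrC -cdfB //; apply: pgkE => [||x /=|x /Auv].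
  + by rewrite v0.
  + by [].
  + by rewrite in_itv => /itvoo_mul_lt0; rewrite mulrC; exact: uvA.
  + by rewrite mulrC /= in_itv; exact: mul_le0_itvcc.
Qed.

End perturbed_gauss_kuzmin.

Theorem theorem2 (R : realType) (N : nat) :
  exists mu : probability (measurableTypeR R) R,
    [/\ has_continuous_density01 mu,
        forall s : seq nat,
          (forall a, a \in s -> (0 < a)%N) -> (size s <= N)%N ->
          mu (@cf_cylinder R s) = mu (@cf_cylinder R (rev s))
      & ~ (forall A : set (measurableTypeR R), measurable A ->
             mu A = gauss_kuzmin A)].
Proof.
have [al [be [al0 ab be1 gap]]] := @cf_endpoints_gap R N.
exists (pgk al be al0 ab be1); split.
- exists (pgk_density al be); split.
  + by apply: continuous_subspaceT; exact: continuous_pgk_density.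
  + by move=> x _; exact: pgk_density_ge0.
  + by move=> A _; exact: erefl.
- move=> s sp sN; have rp : digits_pos (rev s).
    by move=> a; rewrite mem_rev; exact: sp.
  rewrite pgk_cf_cylinder; [|exact: sp|by move=> y; exact: gap].
  rewrite pgk_cf_cylinder; [|exact: rp|]; last first.
    by move=> y; apply: gap; rewrite ?size_rev.
  by rewrite cf_endpoints_ratio_rev.
- exact: pgk_neq_gauss_kuzmin.
Qed.
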